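(* Let $p\in[0,1)$ and $q\in(0,1]$ with $(p,q)\neq(0,1)$. In a round of Knockout with two players, $P_1$ followed by $P_2$, where both players have long shot percentage $p$ and short shot percentage $q$, the probability that $P_2$ is eliminated (that is, the probability that the Markov chain on the game-states $G_1,\dots,G_7$, started in $G_1$, is eventually absorbed in $G_6$) is $\dfrac{1}{3-p}$.
   Context: Two-player Knockout is modelled as an absorbing Markov chain. Both players make a long shot (LS, from the free throw line) with probability $p$ and a short shot (SS) with probability $q$, all shots being independent. Players alternate shots, $P_1$ shooting first in each step. After missing any shot, a player's next shot is a short shot. A player who makes a basket without being eliminated next takes a long shot, and is then behind the other player. The player who is behind eliminates the player in front by making a basket before the player in front does. The game-states are: $G_1$: $P_2$ can win; $P_1$ takes LS, then $P_2$ takes LS. $G_2$: $P_2$ can win; $P_1$ takes SS, then $P_2$ takes SS. $G_3$: $P_2$ can win; $P_1$ takes SS, then $P_2$ takes LS. $G_4$: $P_1$ can win; $P_1$ takes LS, then $P_2$ takes SS. $G_5$: $P_1$ can win; $P_1$ takes SS, then $P_2$ takes SS. $G_6$: absorbing; $P_2$ is eliminated, so $P_1$ wins. $G_7$: absorbing; $P_1$ is eliminated, so $P_2$ wins. The round starts in $G_1$. The transition probabilities (all others being $0$) are: From $G_1$: to $G_1$ with probability $p^2$, to $G_2$ with $(1-p)^2$, to $G_4$ with $p(1-p)$, to $G_7$ with $(1-p)p$. From $G_2$: to $G_1$ with $q^2$, to $G_2$ with $(1-q)^2$, to $G_4$ with $q(1-q)$, to $G_7$ with $(1-q)q$. From $G_3$: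 to $G_1$ with $qp$, to $G_2$ with $(1-q)(1-p)$, to $G_4$ with $q(1-p)$, to $G_7$ with $(1-q)p$. From $G_4$: to $G_3$ with $(1-p)q$, to $G_5$ with $(1-p)(1-q)$, to $G_6$ with $p$. From $G_5$: to $G_3$ with $(1-q)q$, to $G_5$ with $(1-q)^2$, to $G_6$ with $q$. $G_6$ and $G_7$ are absorbing (they stay put with probability $1$). *)

(* Defs.v *)
From HB Require Import structures.
From mathcomp Require Import all_boot all_order all_algebra.
From mathcomp Require Import all_classical all_reals all_analysis.

Set Implicit Arguments.
Unset Strict Implicit.
Unset Printing Implicit Defensive.

Import Order.TTheory GRing.Theory Num.Theory.
Import numFieldNormedType.Exports.

Local Open Scope classical_set_scope.
Local Open Scope ring_scope.

Section MarkovChain.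
Context (d : measure_display) (T : measurableType d) (R : realType).
Variable P : probability T R.

Definition cond_prob (A B : set T) : R := fine (P (A `&` B)) / fine (P B).

Variables (S : finType) (X : nat -> T -> S).

Definition at_time (n : nat) (s : S) : set T := [set w | X n w = s].

Definition history (n : nat) (s : nat -> S) : set T :=
  [set w | forall i, (i <= n)%N -> X i w = s i].

(* [s0] is the initial state and [M s t] the probability of a step from [s]
   to [t].  [S] is finite, so measurability of [X n] for the discrete
   sigma-algebra on [S] amounts to measurability of the fibers. *)
Record markov_chain (s0 : S) (M : S -> S -> R) : Prop := MarkovChain {
  mc_measurable : forall n s, measurable (at_time n s) ;
  mc_start : P (at_time 0 s0) = 1%E ;
  mc_step : forall n (s : nat -> S) (t : S), P (history n s) != 0%E ->
    cond_prob (at_time n.+1 t) (history n s) = M (s n) t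
}.

(* For an absorbing state [s], reaching [s] is being absorbed in [s]. *)
Definition eventually_in (s : S) : set T := [set w | exists n, X n w = s].

End MarkovChain.

(* Two-player Knockout, player P_1 shooting first in each step (LS = long shot,
   SS = short shot):
   G1: P_2 can win; P_1 takes LS, then P_2 takes LS
   G2: P_2 can win; P_1 takes SS, then P_2 takes SS
   G3: P_2 can win; P_1 takes SS, then P_2 takes LS
   G4: P_1 can win; P_1 takes LS, then P_2 takes SS
   G5: P_1 can win; P_1 takes SS, then P_2 takes SS
   G6: P_2 is eliminated, P_1 wins
   G7: P_1 is eliminated, P_2 wins *)
Inductive game_state := G1 | G2 | G3 | G4 | G5 | G6 | G7.

Definition ord_of_game_state (g : game_state) : 'I_7 :=
  match g with
  | G1 => inord 0 | G2 => inord 1 | G3 => inord 2 | G4 => inord 3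
  | G5 => inord 4 | G6 => inord 5 | G7 => inord 6
  end.

Definition game_state_of_ord (i : 'I_7) : game_state :=
  nth G1 [:: G1; G2; G3; G4; G5; G6; G7] i.

Lemma ord_of_game_stateK : cancel ord_of_game_state game_state_of_ord.
Proof. by case; rewrite /game_state_of_ord /= inordK. Qed.

HB.instance Definition _ :=
  Finite.copy game_state (can_type ord_of_game_stateK).

(* [p] is the long shot percentage and [q] the short shot percentage. *)
Definition knockout_trans (R : realType) (p q : R) (s t : game_state) : R :=
  match s, t with
  | G1, G1 => p ^+ 2
  | G1, G2 => (1 - p) ^+ 2
  | G1, G4 => p * (1 - p)
  | G1, G7 => (1 - p) * p
  | G2, G1 => q ^+ 2
  | G2, G2 => (1 - q) ^+ 2
  | G2, G4 => q * (1 - q)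
  | G2, G7 => (1 - q) * q
  | G3, G1 => q * p
  | G3, G2 => (1 - q) * (1 - p)
  | G3, G4 => q * (1 - p)
  | G3, G7 => (1 - q) * p
  | G4, G3 => (1 - p) * q
  | G4, G5 => (1 - p) * (1 - q)
  | G4, G6 => p
  | G5, G3 => (1 - q) * q
  | G5, G5 => (1 - q) ^+ 2
  | G5, G6 => q
  | G6, G6 => 1
  | G7, G7 => 1
  | _, _ => 0
  end.

(* Main.v *)
Require Import Defs.
From mathcomp Require Import all_boot all_order all_algebra.
From mathcomp Require Import all_classical all_reals all_analysis.
From mathcomp Require Import ring lra.

Local Open Scope classical_set_scope.
Local Open Scope ring_scope.

Import Order.TTheory GRing.Theory Num.Theory.
Import numFieldNormedType.Exports.

(** The answer is the value at G1 of a function h on the states that is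
    harmonic for the transition matrix and equals 1 at G6 and 0 at G7.
    Harmonicity makes the mean of h (X n) independent of n, so it stays equal
    to h G1 ([harmonic_mean]).  As n grows, the probability of sitting in one
    of the five non-absorbing states tends to 0, hence the mean of h (X n)
    tends to the limit of P (X n = G6), which is the probability of being
    absorbed in G6 ([absorption_prob]).  Comparing the two gives
    P (absorption in G6) = h G1.

    For Knockout, h is [knockout_value]: it takes the same value 1 / (3 - p)
    at G1 and G2, and twice that value at G4.  In G1 and in G2 both players
    shoot with equal chances, so a jump to G4 is as likely as one to G7, and
    the values 2 / (3 - p) and 0 average back to 1 / (3 - p) whatever the
    shooting percentage is.

    The mass of the non-absorbing states vanishes by a backward propagation
    along the arrows of the chain.  The mass of an absorbing state is
    nondecreasing and bounded, so its increments tend to 0, and each of them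
    dominates a fixed multiple of the mass of any state that can jump there
    ([law_cvg0_next_to_absorbing]).  Likewise, if the mass of t vanishes, so
    does the mass of every state that can jump to t ([law_cvg0_step]).  Some
    arrows exist only when p > 0 and others only when q < 1.  At
    (p, q) = (0, 1) the chain is stuck in the cycle G1, G2, G1 and nothing is
    ever absorbed; for all other p < 1 and q > 0, every state leads to G6 or
    G7. *)

(** * Laws of a finite Markov chain *)

Lemma total_probability {d : measure_display} {T : measurableType d}
    {R : realType} (P : probability T R) {I : finType} (g : T -> I)
    (A : set T) :
  measurable A -> (forall i, measurable (g @^-1` [set i])) ->
  fine (P A) = \sum_i fine (P (A `&` g @^-1` [set i])).
Proof.
move=> mA mg.
have mAg i : measurable (A `&` g @^-1` [set i]) by exact: measurableI.
have enumT : [set` index_enum I] = setT :> set I.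
  by apply/seteqP; split=> i _ //=; rewrite mem_index_enum.
have -> : P A = (\sum_i P (A `&` g @^-1` [set i]))%E.
  rewrite (@fsbig_seq _ _ _ _ (index_enum I)) ?index_enum_uniq// enumT.
  rewrite -measure_fin_bigcup//.
  - by rewrite -setI_bigcupr -preimage_bigcup (_ : \bigcup_i [set i] = setT)
      ?preimage_setT ?setIT//; apply/seteqP; split=> i // _; exists i.
  - exact: finite_finset.
  - by move=> i j _ _ [w] /= [[_ <-] [_ <-]].
rewrite -sum_fine// => i _; exact: fin_num_measure.
Qed.

Section FiniteMarkovChain.
Context {d : measure_display} {T : measurableType d} {R : realType}.
Context {P : probability T R} {S : finType} {X : nat -> T -> S}.
Context {s0 : S} {M : S -> S -> R}.
Hypothesis chainX : markov_chain P X s0 M.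

Let law n s : R := fine (P (at_time X n s)).

Let measurable_at n s : measurable (at_time X n s).
Proof. exact: (mc_measurable chainX). Qed.

Let fin_prob (A : set T) : measurable A -> (P A \is a fin_num).
Proof. exact: fin_num_measure. Qed.

Let measurable_history n x : measurable (history X n x).
Proof.
rewrite (_ : history X n x = \bigcap_(i in `I_n.+1) at_time X i (x i)).
  by apply: bigcap_measurable => [|i _]//; exists 0%N.
by apply/seteqP; split=> w /= h i; [exact: h | move=> /h].
Qed.

(** The product form of the Markov property has no division, so it covers
    the histories of probability 0 as well. *)
Lemma history_step n (x : nat -> S) (t : S) :
  fine (P (history X n x `&` at_time X n.+1 t)) =
  fine (P (history X n x)) * M (x n) t.
Proof.
have mH := measurable_history n x.
have mI := measurableI _ _ mH (measurable_at n.+1 t).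
have [H0|H0] := eqVneq (P (history X n x)) 0%E.
  by rewrite H0 mul0r (subset_measure0 mI mH _ H0) => // w [].
rewrite -(mc_step chainX t H0) /cond_prob mulrCA mulfV ?mulr1 1?setIC//.
by rewrite fine_eq0// fin_prob.
Qed.

(** Conditioning on the whole past reduces to conditioning on the present:
    the event X n = s splits into the finitely many trajectories up to time n
    that end in s, and all of them have the same transition probability
    M s t. *)
Lemma joint_law_step n s t :
  fine (P (at_time X n s `&` at_time X n.+1 t)) = law n s * M s t.
Proof.
pose traj w : {ffun 'I_n.+1 -> S} := [ffun i => X (val i) w].
pose ext (f : {ffun 'I_n.+1 -> S}) (i : nat) := f (inord i).
have trajE f : traj @^-1` [set f] = history X n (ext f).
  apply/seteqP; split=> w /=.
    by move=> <- i ilen; rewrite /ext ffunE /= inordK.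
  move=> h; apply/ffunP => i; rewrite ffunE h ?/ext ?inord_val//.
  exact: leq_ord.
have mtraj f : measurable (traj @^-1` [set f]).
  by rewrite trajE; exact: measurable_history.
rewrite (total_probability P traj)//; last exact: measurableI.
rewrite /law (total_probability P traj _ (measurable_at n s))// mulr_suml.
apply: eq_bigr => f _; rewrite trajE.
have [fs|fs] := eqVneq (ext f n) s.
  have sub : history X n (ext f) `<=` at_time X n s.
    by move=> w /= h; rewrite /at_time /= h.
  by rewrite -setIA (setIC (at_time X n.+1 t)) setIA (setIidr sub)
    history_step fs.
have E0 : at_time X n s `&` history X n (ext f) = set0.
  apply/seteqP; split=> w //= -[ws h]; move: fs.
  by rewrite -(h n (leqnn n)) ws eqxx.
by rewrite setIAC E0 set0I measure0 mul0r.
Qed.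

Lemma law_step n t : law n.+1 t = \sum_s law n s * M s t.
Proof.
rewrite /law (total_probability P (X n)) => [||s]; last exact: measurable_at.
  by apply: eq_bigr => s _; rewrite -joint_law_step setIC.
exact: measurable_at.
Qed.

Lemma law_ge0 n s : 0 <= law n s.
Proof. exact: fine_ge0. Qed.

Lemma law_start s : law 0 s = (s == s0)%:R.
Proof.
have l0 : law 0 s0 = 1 by rewrite /law (mc_start chainX).
have [->//|ns] := eqVneq s s0.
have : \sum_s law 0 s = 1.
  rewrite -[RHS]/(fine 1%E) -(probability_setT P).
  rewrite (total_probability P (X 0%N) setT)//; last exact: measurable_at.
  by apply: eq_bigr => i _; rewrite setTI.
rewrite (bigD1 s0)//= l0 (bigD1 s)//= => h.
have : 0 <= \sum_(i | (i != s0) && (i != s)) law 0 i.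
  by apply: sumr_ge0 => i _; exact: law_ge0.
have := law_ge0 0 s; rewrite /=; lra.
Qed.

(** One step of the chain moves the transition matrix from the law onto h,
    where harmonicity absorbs it. *)
Lemma harmonic_mean (h : S -> R) :
  (forall s, \sum_t M s t * h t = h s) ->
  forall n, \sum_s law n s * h s = h s0.
Proof.
move=> harm; elim=> [|n <-].
  rewrite (bigD1 s0)//= big1 => [|s /negPf ns]; rewrite law_start ?ns ?mul0r//.
  by rewrite eqxx mul1r addr0.
under eq_bigr do rewrite law_step mulr_suml.
rewrite exchange_big /=; apply: eq_bigr => s _.
by rewrite -harm mulr_sumr; apply: eq_bigr => t _; rewrite mulrA.
Qed.

(** * Absorption and vanishing mass *)

(** M s s = 1 is a statement about probabilities, so a path may leave s, but
    only within a null set.  Up to such sets, having visited s by time n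
    is the same event as being in s at time n. *)
Lemma prob_visited_absorbing n s : M s s = 1 ->
  P (\bigcup_(i in `I_n.+1) at_time X i s) = P (at_time X n s).
Proof.
move=> Mss; pose D n := \bigcup_(i in `I_n.+1) at_time X i s.
have mD k : measurable (D k) by apply: bigcup_measurable => i _.
have mC := measurable_at ^~ s.
have leave k : P (at_time X k s `\` at_time X k.+1 s) = 0%E.
  have mCC := measurableI _ _ (mC k) (mC k.+1).
  rewrite measureD// ?ltey_eq ?fin_prob//.
  rewrite -[X in (_ - X)%E]fineK ?fin_prob// joint_law_step Mss mulr1.
  by rewrite fineK ?fin_prob// subee ?fin_prob.
have past : P (D n `\` at_time X n s) = 0%E.
  elim: n => [|n IH].
    rewrite (_ : _ `\` _ = set0) ?measure0//.
    by apply/seteqP; split=> w //= [[i /=]]; case: i.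
  have : P ((D n `\` at_time X n s) `|` (at_time X n s `\` at_time X n.+1 s))
      = 0%E.
    by rewrite measureU0 ?IH//; [exact: measurableD..|exact: leave].
  apply: subset_measure0; [exact: measurableD| |].
    by apply: measurableU; exact: measurableD.
  move=> w /= [[i /= ilt Xi] nX].
  have [Xn|Xn] := pselect (X n w = s); [by right|left; split=> //].
  exists i => //=; move: ilt.
  rewrite [(i < n.+2)%N]leq_eqVlt => /orP[/eqP[E]|//].
  by case: nX; rewrite -E.
have sub : at_time X n s `<=` D n by move=> w ?; exists n => /=.
have : P (D n) = (P (D n `\` at_time X n s) + P (D n `&` at_time X n s))%E.
  by apply: measureDI.
by rewrite past add0e setIC (setIidl sub).
Qed.

(** Absorption is the increasing union over n of the events that s has been
    visited by time n, so continuity from below applies. *)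
Lemma law_cvg_absorbed s : M s s = 1 ->
  law n s @[n --> \oo] --> fine (P (eventually_in X s)).
Proof.
move=> Mss; pose D n := \bigcup_(i in `I_n.+1) at_time X i s.
have mD k : measurable (D k) by apply: bigcup_measurable => i _.
have DE : \bigcup_n D n = eventually_in X s.
  apply/seteqP; split=> w [n]; first by move=> _ [i _ ?]; exists i.
  by move=> Xn; exists n => //; exists n => /=.
have mE : measurable (eventually_in X s).
  by rewrite -DE; exact: bigcupT_measurable.
apply: fine_cvg; rewrite fineK ?fin_prob// -DE.
have -> : (fun n => P (at_time X n s)) = P \o D.
  by apply/funext => n /=; rewrite /D prob_visited_absorbing.
apply: nondecreasing_cvg_mu => //; first by rewrite DE.
move=> m n mn; apply/subsetPset => w [i /= im Xi]; exists i => //=.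
exact: leq_trans im _.
Qed.

Hypothesis M_ge0 : forall s t, 0 <= M s t.

Lemma flow_le n s t : law n s * M s t <= law n.+1 t.
Proof.
rewrite law_step (bigD1 s)//= lerDl; apply: sumr_ge0 => i _.
by rewrite mulr_ge0 ?law_ge0.
Qed.

Let law_cvg0 s (u : nat -> R) (c : R) : 0 < c ->
  (forall n, law n s * c <= u n) -> u n @[n --> \oo] --> 0 ->
  law n s @[n --> \oo] --> 0.
Proof.
move=> c0 le u0.
apply: (@squeeze_cvgr _ _ _ _ (fun=> 0) (fun n => u n / c)).
- by apply: nearW => n; rewrite law_ge0 ler_pdivlMr//= le.
- exact: cvg_cst.
- by rewrite -[X in _ --> X](mul0r c^-1); apply: cvgMl.
Qed.

(** The increments of the convergent sequence n |-> P (X n = t) tend to 0, and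
    each is the total inflow into t, at least P (X n = s) * M s t. *)
Lemma law_cvg0_next_to_absorbing s t : M t t = 1 -> s <> t -> 0 < M s t ->
  law n s @[n --> \oo] --> 0.
Proof.
move=> Mtt /eqP st Mst.
apply: (@law_cvg0 _ (fun n => law n.+1 t - law n t) _ Mst).
  move=> n; rewrite law_step (bigD1 t)//= Mtt mulr1 addrAC subrr add0r.
  rewrite (bigD1 s)//= lerDl; apply: sumr_ge0 => i _.
  by rewrite mulr_ge0 ?law_ge0.
have cv := law_cvg_absorbed _ Mtt.
rewrite -(subrr (fine (P (eventually_in X t)))); apply: cvgB => //.
by rewrite (cvg_shiftS (fun n => law n t)).
Qed.

Lemma law_cvg0_step s t : 0 < M s t ->
  law n t @[n --> \oo] --> 0 -> law n s @[n --> \oo] --> 0.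
Proof.
move=> Mst cv; apply: (@law_cvg0 _ (fun n => law n.+1 t) _ Mst).
  by move=> n; exact: flow_le.
by rewrite (cvg_shiftS (fun n => law n t)).
Qed.

(** In the constant mean of h (X n), only the term of u survives in the limit:
    every other state either has value 0 or loses its mass. *)
Lemma absorption_prob (h : S -> R) (u : S) :
  (forall s, \sum_t M s t * h t = h s) -> M u u = 1 -> h u = 1 ->
  (forall s, s <> u -> h s = 0 \/ law n s @[n --> \oo] --> 0) ->
  P (eventually_in X u) = (h s0)%:E.
Proof.
move=> harm Muu hu rest.
have mE : measurable (eventually_in X u).
  rewrite (_ : eventually_in X u = \bigcup_n at_time X n u).
    exact: bigcupT_measurable.
  by apply/seteqP; split=> w [n]; [exists n | move=> _ ?; exists n].
rewrite -[LHS]fineK ?fin_prob//; congr EFin.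
have lim_u : (\sum_s law n s * h s) @[n --> \oo]
    --> fine (P (eventually_in X u)).
  rewrite (_ : fine _ = \sum_s (if s == u then fine (P (eventually_in X u))
                                     else 0));
    last by rewrite -big_mkcond big_pred1_eq.
  apply: cvg_big => [|s _]; first exact: add_continuous.
  have [->|su] := eqVneq s u.
    by rewrite hu; under eq_fun do rewrite mulr1; exact: law_cvg_absorbed.
  case: (rest s (elimN eqP su)) => [->|cv].
    by under eq_fun do rewrite mulr0; exact: cvg_cst.
  by rewrite -[X in _ --> X](mul0r (h s)); apply: cvgMl.
have lim_h : (\sum_s law n s * h s) @[n --> \oo] --> h s0.
  by under eq_fun do rewrite (harmonic_mean _ harm); exact: cvg_cst.
exact: (cvg_unique _ lim_u lim_h).
Qed.

End FiniteMarkovChain.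

(** * The Knockout chain *)

(** The solution, with values 1 at G6 and 0 at G7, of the linear system of
    one-step equations for the probability that P_1 wins. *)
Definition knockout_value {R : realType} (p q : R) (s : game_state) : R :=
  match s with
  | G1 | G2 => 1 / (3 - p)
  | G3 => (1 + q - p) / (3 - p)
  | G4 => 2 / (3 - p)
  | G5 => (2 + q - p) / (3 - p)
  | G6 => 1
  | G7 => 0
  end.

Lemma sum_game_state {R : realType} (F : game_state -> R) :
  \sum_s F s = F G1 + F G2 + F G3 + F G4 + F G5 + F G6 + F G7.
Proof.
have bij : {on [pred _ | true], bijective game_state_of_ord}.
  exists ord_of_game_state => [i _|s _]; last exact: ord_of_game_stateK.
  by apply/val_inj; case: i => -[|[|[|[|[|[|[|//]]]]]]] ?; rewrite /= inordK.
rewrite (reindex game_state_of_ord)//= !big_ord_recl big_ord0 addr0 /=.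
by rewrite !addrA.
Qed.

Lemma knockout_value_harmonic {R : realType} (p q : R) : p < 1 ->
  forall s, \sum_t knockout_trans p q s t * knockout_value p q t
            = knockout_value p q s.
Proof.
move=> hp1 s; have p3 : 3 - p != 0 by apply/eqP; lra.
by rewrite sum_game_state; case: s => /=; field.
Qed.

Lemma knockout_trans_ge0 {R : realType} (p q : R) :
  0 <= p -> p <= 1 -> 0 <= q -> q <= 1 ->
  forall s t, 0 <= knockout_trans p q s t.
Proof.
move=> p0 p1 q0 q1.
have p1' : 0 <= 1 - p by rewrite subr_ge0.
have q1' : 0 <= 1 - q by rewrite subr_ge0.
by case; case=> //=; rewrite ?expr2 ?mulr_ge0.
Qed.

Theorem theorem3p1 (R : realType) (p q : R)
    (hp0 : 0 <= p) (hp1 : p < 1) (hq0 : 0 < q) (hq1 : q <= 1)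
    (hpq : (p, q) <> (0, 1))
    (d : measure_display) (T : measurableType d) (P : probability T R)
    (X : nat -> T -> game_state)
    (hX : markov_chain P X G1 (knockout_trans p q)) :
  P (eventually_in X G6) = (1 / (3 - p))%:E.
Proof.
have M_ge0 : forall s t, 0 <= knockout_trans p q s t.
  by apply: knockout_trans_ge0 => //; exact: ltW.
have absorb := law_cvg0_next_to_absorbing hX M_ge0.
have step := law_cvg0_step hX M_ge0.
have p1 : 0 < 1 - p by rewrite subr_gt0.
have trans5 : fine (P (at_time X n G5)) @[n --> \oo] --> 0.
  exact: (absorb G5 G6).
(* If p > 0, a made long shot ends the game from G1 or G4.  If p = 0, then
   q < 1: G4 goes through G5, and G1 goes through G2, where P_1 can miss and
   P_2 score. *)
have [trans1 trans4] : (fine (P (at_time X n G1)) @[n --> \oo] --> 0) /\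
                       (fine (P (at_time X n G4)) @[n --> \oo] --> 0).
  have [p_gt0|p_le0] := ltP 0 p.
    split; first by apply: (absorb G1 G7) => //=; exact: mulr_gt0.
    exact: (absorb G4 G6).
  have p0 : p = 0 by apply/le_anti; rewrite p_le0.
  have q1 : 0 < 1 - q.
    rewrite subr_gt0 lt_neqAle hq1 andbT.
    by apply/eqP => q1; apply: hpq; rewrite p0 q1.
  split; last by apply: (step G4 G5) => //=; exact: mulr_gt0.
  apply: (step G1 G2) => /=; first exact: exprn_gt0.
  by apply: (absorb G2 G7) => //=; exact: mulr_gt0.
have trans2 : fine (P (at_time X n G2)) @[n --> \oo] --> 0.
  by apply: (step G2 G1) => //=; exact: exprn_gt0.
have trans3 : fine (P (at_time X n G3)) @[n --> \oo] --> 0.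
  by apply: (step G3 G4) => //=; exact: mulr_gt0.
apply: (absorption_prob hX (knockout_value p q) G6) => //.
  exact: knockout_value_harmonic.
by case=> // _; [right..|left].
Qed.
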